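(* For every Tychonoff space $T$ there exists a complete metric space $(X,d)$ which is locally $\mathbb{R}$ such that $T$ is homeomorphic to a closed subspace of the Wijsman hyperspace $2^{(X,d)}$.
   Context: For a metric space $(X,d)$, let $2^X$ denote the set of all non-empty closed subsets of $X$, and for $x\in X$, $F\in 2^X$ let $d(x,F)=\inf\{d(x,y): y\in F\}$. The Wijsman topology $\tau_{w(d)}$ on $2^X$ is the weakest topology making all the functions $F\mapsto d(x,F)$, $x\in X$, continuous (equivalently, the topology of pointwise convergence when $F$ is identified with the distance function $d(\cdot,F)$). The Wijsman hyperspace of $(X,d)$ is $2^{(X,d)}=(2^X,\tau_{w(d)})$. A space is locally $\mathbb{R}$ if every point has an open neighborhood homeomorphic to $\mathbb{R}$. A Tychonoff space is a completely regular $T_1$-space. *)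

(* Defs.v *)
From HB Require Import structures.
From mathcomp Require Import all_boot all_order all_algebra.
From mathcomp Require Import all_classical reals topology normedtype.

Set Implicit Arguments.
Unset Strict Implicit.
Unset Printing Implicit Defensive.

Import Order.TTheory GRing.Theory Num.Theory.
Import numFieldNormedType.Exports.

Local Open Scope classical_set_scope.
Local Open Scope ring_scope.

Definition homeomorphic (S T : topologicalType) : Prop :=
  exists (f : S -> T) (g : T -> S),
    [/\ cancel f g, cancel g f, continuous f & continuous g].

(* By uniform_separatorP, completely_regular_space amounts to the separation of
   points from closed sets by continuous functions into [0, 1]. *)
Definition tychonoff_space (T : topologicalType) : Prop :=
  accessible_space T /\ completely_regular_space T.

(* The axiom of completeType, without requiring the space to be pointed. *)
Definition complete_space (X : uniformType) : Prop :=
  forall F : set_system X, ProperFilter F -> cauchy F -> exists x : X, F --> x.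

Definition locally_real (R : realType) (X : topologicalType) : Prop :=
  forall x : X, exists U : set X, [/\ open U, U x & homeomorphic (set_type U) R].

Definition dist_set (R : realType) (X : metricType R) (x : X) (F : set X) : R :=
  inf [set mdist x y | y in F].

Definition nonempty_closed (X : topologicalType) : Type :=
  set_type [set F : set X | closed F /\ F !=set0].

HB.instance Definition _ (X : topologicalType) := Choice.on (nonempty_closed X).

Definition wijsman (R : realType) (X : metricType R) : Type := nonempty_closed X.

(* The supremum, over x, of the initial topologies of F |-> d(x, F), that is,
   the weakest topology making all these functions continuous. *)
HB.instance Definition _ (R : realType) (X : metricType R) :=
  Topological.copy (wijsman X) (sup_topology (fun x : X => Topological.class
    (initial_topology (fun F : nonempty_closed X => dist_set x (set_val F))))).

(* Main.v *)
(* Let I be the set of continuous functions f : T -> [0, 1].  A point t of T is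
   coded by the graph {(f, f t)} in the disjoint union I x R of lines, each
   metrized by min(|r - s|, 1), distinct lines being at distance 1.  The distance
   from (f, r) to this graph is min(|r - f t|, 1), so complete regularity makes the
   coding an embedding; its limits in the hyperspace are graphs of functionals
   l : I -> R.  To expel the limits not coming from T, a further line is added for
   each l which is at uniform distance at least 1 from every evaluation; its points
   are at distance 2 - min(|r - l f|, 1) from (f, r), hence at distance 1 from every
   graph coming from T (and from any limit of these), but at distance 2 from the graph
   of l.  Any other limit functional l is within distance 1 of some evaluation at t,
   and then equals it: otherwise a rescaling of |f - f t| would separate them by 1. *)
Require Import Defs.
From HB Require Import structures.
From mathcomp Require Import all_boot all_order all_algebra.
From mathcomp Require Import all_classical reals topology normedtype.
From mathcomp Require Import lra.

Set Implicit Arguments.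
Unset Strict Implicit.
Unset Printing Implicit Defensive.

Import Order.TTheory GRing.Theory Num.Theory.
Import numFieldNormedType.Exports.

Local Open Scope classical_set_scope.
Local Open Scope ring_scope.

(** * The truncated metric on a line *)

Section TruncatedDistance.
Context {R : realType}.
Implicit Types x y z : R.

Definition trunc_dist x y : R := Num.min `|x - y| 1.

Lemma trunc_distxx x : trunc_dist x x = 0.
Proof. by rewrite /trunc_dist subrr normr0 min_l// ler01. Qed.

Lemma trunc_dist_ge0 x y : 0 <= trunc_dist x y.
Proof. by rewrite le_min normr_ge0 ler01. Qed.

Lemma trunc_dist_le1 x y : trunc_dist x y <= 1.
Proof. by rewrite ge_min lexx orbT. Qed.

Lemma trunc_dist_le x y : trunc_dist x y <= `|x - y|.
Proof. by rewrite ge_min lexx. Qed.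

Lemma trunc_dist_sym x y : trunc_dist x y = trunc_dist y x.
Proof. by rewrite /trunc_dist distrC. Qed.

Lemma trunc_dist_triangle x y z :
  trunc_dist x z <= trunc_dist x y + trunc_dist y z.
Proof.
rewrite /trunc_dist; have := ler_distD y x z.
have := normr_ge0 (x - y); have := normr_ge0 (y - z).
by case: (leP `|x - z| 1); case: (leP `|x - y| 1); case: (leP `|y - z| 1) => *; lra.
Qed.

Lemma trunc_dist_eq0 x y : trunc_dist x y = 0 -> x = y.
Proof.
rewrite /trunc_dist; case: leP => [_ /normr0_eq0/subr0_eq//|_ /eqP].
by rewrite oner_eq0.
Qed.

Lemma trunc_dist01 x y : 0 <= x <= 1 -> 0 <= y <= 1 -> trunc_dist x y = `|x - y|.
Proof.
by move=> /andP[? ?] /andP[? ?]; rewrite /trunc_dist min_l// ler_norml; apply/andP; split; lra.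
Qed.

Lemma continuous_trunc_dist x : continuous (trunc_dist x).
Proof.
move=> y.
apply: (@continuous_min _ _ (fun y => `|x - y|) (cst 1)); last exact: cvg_cst.
by apply: cvg_norm; apply: cvgB; [exact: cvg_cst|exact: cvg_id].
Qed.

End TruncatedDistance.

(** * The disjoint union of lines as a complete, locally real metric space *)

Definition lines (R : realType) (I : Type) (L : set (I -> R)) : Type :=
  ((I + L) * R)%type.

Section Lines.
Context {R : realType} {I : Type} {L : set (I -> R)}.
Implicit Types x y z : lines L.

Definition cross_dist x y : R :=
  match x.1, y.1 with
  | inl i, inr l => 2 - trunc_dist x.2 (val l i)
  | inr l, inl i => 2 - trunc_dist y.2 (val l i)
  | _, _ => 1
  end.

Definition lines_dist x y : R :=
  if `[< x.1 = y.1 >] then trunc_dist x.2 y.2 else cross_dist x y.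

Lemma lines_dist_same x y : x.1 = y.1 -> lines_dist x y = trunc_dist x.2 y.2.
Proof. by rewrite /lines_dist; case: asboolP. Qed.

Lemma lines_dist_cross x y : x.1 <> y.1 -> lines_dist x y = cross_dist x y.
Proof. by rewrite /lines_dist; case: asboolP. Qed.

Lemma cross_dist_sym x y : cross_dist x y = cross_dist y x.
Proof. by case: x y => [[i|l] r] [[j|m] s]. Qed.

Lemma cross_dist_ge1 x y : 1 <= cross_dist x y.
Proof.
case: x y => [[i|l] r] [[j|m] s]; rewrite /cross_dist /= ?lexx//.
  by have := trunc_dist_le1 r (val m i); lra.
by have := trunc_dist_le1 s (val l j); lra.
Qed.

Lemma cross_dist_le2 x y : cross_dist x y <= 2.
Proof.
case: x y => [[i|l] r] [[j|m] s]; rewrite /cross_dist /= ?ler1n//.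
  by have := trunc_dist_ge0 r (val m i); lra.
by have := trunc_dist_ge0 s (val l j); lra.
Qed.

(** Moving along a line changes [cross_dist] at most through a term [2 - trunc_dist], which is
    1-Lipschitz by the triangle inequality for [trunc_dist]. *)
Lemma cross_dist_lipschitz x y z : x.1 = y.1 ->
  cross_dist x z <= trunc_dist x.2 y.2 + cross_dist y z.
Proof.
case: x y z => [j r] [_ s] [k t] /= <-; rewrite /cross_dist /=.
have := trunc_dist_ge0 r s.
case: j k => [i|l] [k|m]; try lra.
have := trunc_dist_triangle s r (val m i).
by rewrite (trunc_dist_sym s r); lra.
Qed.

Lemma lines_distxx x : lines_dist x x = 0.
Proof. by rewrite lines_dist_same// trunc_distxx. Qed.

Lemma lines_dist_lt1 x y : lines_dist x y < 1 -> x.1 = y.1.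
Proof.
by apply: contraPP => /lines_dist_cross ->; apply/negP; rewrite -leNgt cross_dist_ge1.
Qed.

(** Capping the radius at 1 keeps a ball inside one line, where small distances are the usual ones;
    this makes [line_coord] continuous and turns Cauchy filters into Cauchy filters of
    coordinates. *)
Lemma lines_dist_lt x y (e : R) : lines_dist x y < Num.min e 1 ->
  x.1 = y.1 /\ `|x.2 - y.2| < e.
Proof.
rewrite lt_min => /andP[+ xy]; have xy1 := lines_dist_lt1 xy; move: xy.
by rewrite (lines_dist_same xy1) /trunc_dist gt_min ltxx orbF => /ltW/min_idPl ->.
Qed.

Lemma lines_dist_eq0 x y : lines_dist x y = 0 -> x = y.
Proof.
move=> xy0; have xy1 : x.1 = y.1 by apply: lines_dist_lt1; rewrite xy0 ltr01.
move: xy0; rewrite lines_dist_same// => /trunc_dist_eq0.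
by case: x y xy1 => [? ?] [? ?] /= -> ->.
Qed.

Lemma lines_dist_sym x y : lines_dist x y = lines_dist y x.
Proof.
have [xy|xy] := pselect (x.1 = y.1).
  by rewrite (lines_dist_same xy) (lines_dist_same (esym xy)) trunc_dist_sym.
by rewrite (lines_dist_cross xy) (lines_dist_cross (nesym xy)) cross_dist_sym.
Qed.

Lemma lines_dist_triangle y x z :
  lines_dist x z <= lines_dist x y + lines_dist y z.
Proof.
have [xy|xy] := pselect (x.1 = y.1); have [yz|yz] := pselect (y.1 = z.1).
- have xz := etrans xy yz.
  rewrite (lines_dist_same xy) (lines_dist_same yz) (lines_dist_same xz).
  exact: trunc_dist_triangle.
- have xz : x.1 <> z.1 by rewrite xy.
  rewrite (lines_dist_same xy) (lines_dist_cross yz) (lines_dist_cross xz).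
  exact: cross_dist_lipschitz.
- have xz : x.1 <> z.1 by rewrite -yz.
  rewrite (lines_dist_same yz) (lines_dist_cross xy) (lines_dist_cross xz).
  rewrite cross_dist_sym (cross_dist_sym x) addrC (trunc_dist_sym y.2).
  exact: cross_dist_lipschitz.
(* Both legs have length at least 1, and no distance exceeds 2. *)
- rewrite (lines_dist_cross xy) (lines_dist_cross yz).
  have := cross_dist_ge1 x y; have := cross_dist_ge1 y z.
  rewrite /lines_dist; case: asboolP => _.
    by have := trunc_dist_le1 x.2 z.2; lra.
  by have := cross_dist_le2 x z; lra.
Qed.

HB.instance Definition _ := gen_eqMixin (lines L).
HB.instance Definition _ := gen_choiceMixin (lines L).
HB.instance Definition _ := @isMetric.Build R (lines L) lines_dist
  lines_distxx lines_dist_eq0 lines_dist_sym lines_dist_triangle.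

Lemma mdist_linesE x y : mdist x y = lines_dist x y.
Proof. by []. Qed.

Lemma ball_lines x e y : ball x e y = (lines_dist x y < e) :> Prop.
Proof. by rewrite ballEmdist. Qed.

Definition line_coord x : R := x.2.

Definition line_point j r : lines L := (j, r).

Lemma continuous_line_coord : continuous line_coord.
Proof.
move=> x; apply/(@cvgrPdist_lt _ _ _ (nbhs (x : lines L))) => e e0.
have m0 : 0 < Num.min e 1 by rewrite lt_min e0 ltr01.
apply/nbhs_ballP; exists (Num.min e 1) => //= y; rewrite ball_lines.
by case/lines_dist_lt.
Qed.

Lemma continuous_line_point j : continuous (line_point j).
Proof.
move=> r; apply/cvg_ballP => e e0; near=> s.
rewrite ball_lines lines_dist_same//=; apply: le_lt_trans (trunc_dist_le _ _) _.
near: s; exact: cvgr_dist_lt.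
Unshelve. all: by end_near. Qed.

Lemma lines_locally_real : locally_real R (lines L).
Proof.
move=> x; pose U := [set y : lines L | y.1 = x.1].
have UP (r : R) : line_point x.1 r \in U by rewrite inE.
exists U; split=> //.
  rewrite openE => y /= yx; apply/nbhs_ballP; exists 1 => //= z.
  by rewrite ball_lines => /lines_dist_lt1 yz; rewrite /U /= -yz.
exists (fun y : U => line_coord (set_val y)), (fun r => exist _ (line_point x.1 r) (UP r)); split.
- by move=> [[j r] jU]; apply: val_inj => /=; move: jU; rewrite inE /U /= => ->.
- by [].
- move=> y; apply: (@continuous_comp _ _ _ (set_val : U -> lines L)).
    exact: initial_continuous.
  exact: continuous_line_coord.
- by apply: continuous_comp_initial; exact: continuous_line_point.
Qed.

(** A Cauchy filter contains a ball of radius 1, so it lives on a single line, and its coordinates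
    converge there by completeness of [R]. *)
Lemma lines_complete : complete_space (lines L).
Proof.
move=> F PF /cauchyP Fc.
have [x Fx] := Fc 1 ltr01.
have Gc : cauchy (line_coord @ F : set_system R).
  apply: cauchy_exP => e e0.
  have m0 : 0 < Num.min e 1 by rewrite lt_min e0 ltr01.
  have [z Fz] := Fc _ m0; exists (line_coord z).
  suff: F (line_coord @^-1` ball (line_coord z) e) by [].
  by apply: filterS Fz => y; rewrite ball_lines => /lines_dist_lt[].
have /cauchy_cvgP/cvg_ex[/= r Fr] := Gc.
have Fx1 : \forall y \near F, x.1 = y.1.
  by apply: filterS Fx => y; rewrite ball_lines => /lines_dist_lt1.
have Fr2 (e : R) : 0 < e -> \forall y \near F, `|r - line_coord y| < e.
  by move/cvgrPdist_lt: Fr; exact.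
exists (line_point x.1 r); apply/cvg_ballP => e e0; near=> y.
have xy : x.1 = y.1 by near: y.
rewrite ball_lines lines_dist_same//=; apply: le_lt_trans (trunc_dist_le _ _) _.
by near: y; exact: Fr2.
Unshelve. all: by end_near. Qed.

End Lines.

(** * Distance functions and the Wijsman topology *)

Section Wijsman.
Context {R : realType} {X : metricType R}.

Lemma dist_set_attained (x y : X) (F : set X) :
  F y -> (forall z, F z -> mdist x y <= mdist x z) -> dist_set x F = mdist x y.
Proof.
move=> Fy Fmin; apply/eqP; rewrite eq_le; apply/andP; split.
  apply: ge_inf; last by exists y.
  by exists (mdist x y) => _ [z Fz <-]; exact: Fmin.
by apply: lb_le_inf => [|_ [z Fz <-]]; [exists (mdist x y), y|exact: Fmin].
Qed.

(** This recovers a closed set from its distance function. *)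
Lemma dist_set_eq0 (x : X) (F : set X) :
  closed F -> F !=set0 -> dist_set x F = 0 <-> F x.
Proof.
move=> cF [y0 Fy0]; split=> [d0|Fx]; last first.
  by rewrite (dist_set_attained Fx) ?mdistxx// => z _; exact: mdist_ge0.
apply: cF => A /nbhs_ballP[e /= e0 eA].
have d_neq0 : [set mdist x y | y in F] !=set0 by exists (mdist x y0), y0.
have /(inf_lt d_neq0)[_ [y Fy <-] ye] : inf [set mdist x y | y in F] < e.
  by rewrite -/(dist_set x F) d0.
by exists y; split=> //; apply: eA; rewrite ballEmdist.
Qed.

Lemma continuous_dist_set (x : X) :
  continuous (fun F : wijsman X => dist_set x (set_val F) : R).
Proof.
move=> F; have := (@cvg_sup _ _ _ (nbhs F) F _).1 (@cvg_id _ _) x.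
move=> h A /(@initial_continuous _ _ (fun G : nonempty_closed X =>
  dist_set x (set_val G))) /h.
exact.
Qed.

Lemma continuous_wijsman (T : topologicalType) (f : T -> wijsman X) :
  (forall x, continuous (fun t => dist_set x (set_val (f t)) : R)) ->
  continuous f.
Proof.
move=> fc t; apply/cvg_sup => x.
exact: (@continuous_comp_initial _ _ _ (fun F : nonempty_closed X =>
  dist_set x (set_val F)) f (fc x) t).
Qed.

(** The equalizer of two continuous real functions is closed. Identities between distances thereby
    pass from a set of closed sets to its limits. *)
Lemma wijsman_closure_eq (C : set (wijsman X)) (phi psi : wijsman X -> R) :
  continuous phi -> continuous psi ->
  {in C, phi =1 psi} -> {in closure C, phi =1 psi}.
Proof.
move=> cphi cpsi CE F; rewrite inE => CF; apply/eqP; rewrite -subr_eq0; apply/eqP.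
have cZ : closed ((fun G => phi G - psi G) @^-1` [set 0]).
  apply: preimage_closed; last exact: closed_eq.
  by move=> G _; apply: (@continuousB _ R^o); [apply: cphi|apply: cpsi].
apply: cZ; apply: closure_subset CF => G CG /=.
by rewrite CE ?subrr// inE.
Qed.

End Wijsman.

(** * Graphs of functionals and the distances to them *)

Section Graph.
Context {R : realType} {I : Type} {L : set (I -> R)}.

Definition graph (a : I -> R) : set (lines L) := [set (inl i, a i) | i in setT].

(** The nearest graph point is the one on the same line, all others being at distance 1. *)
Lemma dist_graph_inl (a : I -> R) i r :
  dist_set ((inl i, r) : lines L) (graph a) = trunc_dist r (a i).
Proof.
have di : mdist ((inl i, r) : lines L) (inl i, a i) = trunc_dist r (a i).
  exact: lines_dist_same.
rewrite -di; apply: dist_set_attained => [|_ [k _ <-]]; first by exists i.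
rewrite di mdist_linesE /lines_dist; case: asboolP => [[<-]//|_].
exact: trunc_dist_le1.
Qed.

Lemma mdist_inr_inl (l : L) s i r :
  mdist ((inr l, s) : lines L) (inl i, r) = 2 - trunc_dist r (val l i).
Proof. exact: lines_dist_cross. Qed.

(** At the index [i] the truncation saturates, so the least possible cross distance 1 is
    attained. *)
Lemma dist_graph_inr_far (a : I -> R) (l : L) s i :
  1 <= `|a i - val l i| -> dist_set ((inr l, s) : lines L) (graph a) = 1.
Proof.
move=> ai; have di : mdist ((inr l, s) : lines L) (inl i, a i) = 1.
  by rewrite mdist_inr_inl /trunc_dist min_r//; lra.
rewrite -di; apply: dist_set_attained => [|_ [k _ <-]]; first by exists i.
by rewrite di mdist_inr_inl; have := trunc_dist_le1 (a k) (val l k); lra.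
Qed.

(** The index [i] provides a point of the graph; on an empty graph [inf] would take its default
    value. *)
Lemma dist_graph_inr_self (l : L) s (i : I) :
  dist_set ((inr l, s) : lines L) (graph (val l)) = 2.
Proof.
have dk k : mdist ((inr l, s) : lines L) (inl k, val l k) = 2.
  by rewrite mdist_inr_inl trunc_distxx subr0.
by rewrite -(dk i); apply: dist_set_attained => [|_ [k _ <-]]; rewrite ?dk//; exists i.
Qed.

Lemma closed_graph (a : I -> R) : closed (graph a).
Proof.
rewrite -[graph a]setCK; apply: open_closedC; rewrite openE => -[[i|l] r] nax.
  (* The radius is the distance to the graph point on the same line; being at most 1, it also
     excludes the graph points on other lines. *)
  apply/nbhs_ballP; exists (trunc_dist r (a i)) => [|/= y].
    rewrite /= lt_neqAle trunc_dist_ge0 andbT eq_sym; apply/eqP => /trunc_dist_eq0 ra.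
    by apply: nax; rewrite ra; exists i.
  rewrite ball_lines => + [k _ yk]; rewrite -yk /lines_dist; case: asboolP => /=.
    by move=> [->]; rewrite ltxx.
  by move=> _; have := trunc_dist_le1 r (a i); rewrite /cross_dist /=; lra.
apply/nbhs_ballP; exists 1 => //= y; rewrite ball_lines => /lines_dist_lt1 + [k _ yk].
by rewrite -yk.
Qed.

End Graph.

(** * Coding the points of [T] by graphs of evaluations *)

Section Embedding.
Context (R : realType) (T : topologicalType).

Definition unit_functions : set (T -> R) :=
  [set f : T -> R | continuous f /\ forall t, 0 <= f t <= 1].

Definition evaluation (t : T) (f : unit_functions) : R := set_val f t.

(** Asking for a witness [f], not for a bound on a supremum, makes distance 1 attained; the negation
    gives one [t] with strict bounds at all [f]. *)
Definition remote : set (unit_functions -> R) :=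
  [set l | forall t, exists f, 1 <= `|evaluation t f - l f|].

(** It keeps the graphs nonempty, even when [T] is empty. *)
Definition zero_function : unit_functions.
Proof.
exists (cst 0); rewrite inE; split=> [|t /=]; first exact: cst_continuous.
by rewrite lexx ler01.
Defined.

Lemma evaluation01 t f : 0 <= evaluation t f <= 1.
Proof. by have [_] := set_valP f; exact. Qed.

Lemma continuous_evaluation f : continuous (evaluation ^~ f).
Proof. by have [] := set_valP f. Qed.

Definition evaluation_graph (t : T) : wijsman (lines remote).
Proof.
exists (graph (evaluation t)); rewrite inE; split; first exact: closed_graph.
by exists (inl zero_function, evaluation t zero_function), zero_function.
Defined.

Lemma dist_evaluation_graph_inl t f r :
  dist_set ((inl f, r) : lines remote) (set_val (evaluation_graph t))
  = trunc_dist r (evaluation t f).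
Proof. exact: dist_graph_inl. Qed.

Lemma dist_evaluation_graph_inr t l r :
  dist_set ((inr l, r) : lines remote) (set_val (evaluation_graph t)) = 1.
Proof.
by have := set_valP l => /(_ t)[f]; exact: dist_graph_inr_far.
Qed.

Lemma continuous_evaluation_graph : continuous evaluation_graph.
Proof.
apply: continuous_wijsman => -[[f|l] r].
  under [X in continuous X]eq_fun do rewrite dist_evaluation_graph_inl.
  move=> t; apply: (@continuous_comp _ _ _ (evaluation ^~ f)).
    exact: continuous_evaluation.
  exact: continuous_trunc_dist.
under [X in continuous X]eq_fun do rewrite dist_evaluation_graph_inr.
exact: cst_continuous.
Qed.

Lemma eq_evaluation_graph t u :
  evaluation_graph t = evaluation_graph u -> evaluation t = evaluation u.
Proof.
move=> tu; apply/funext => f; apply/trunc_dist_eq0.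
by rewrite -dist_evaluation_graph_inl -tu dist_evaluation_graph_inl trunc_distxx.
Qed.

(** Evaluations lie in [0, 1], so the distance from the origin of the line [f] to the graph of an
    evaluation is its value at [f], unaffected by truncation. As a distance it makes sense for every
    closed set and is continuous. *)
Definition limit_value (G : wijsman (lines remote)) (f : unit_functions) : R :=
  dist_set ((inl f, 0) : lines remote) (set_val G).

Lemma limit_value_evaluation t : limit_value (evaluation_graph t) = evaluation t.
Proof.
apply/funext => f; rewrite /limit_value dist_evaluation_graph_inl.
have /andP[f0 f1] := evaluation01 t f.
by rewrite trunc_dist01 ?lexx ?ler01 ?f0 ?f1// sub0r normrN ger0_norm.
Qed.

Lemma continuous_limit_value f : continuous (limit_value ^~ f).
Proof. exact: continuous_dist_set. Qed.

(** * Limits of evaluation graphs *)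

Section Closure.
Variables (G : wijsman (lines remote)).
Hypothesis clG : closure (range evaluation_graph) G.

Let closure_eq (phi psi : wijsman (lines remote) -> R) :
  continuous phi -> continuous psi ->
  (forall t, phi (evaluation_graph t) = psi (evaluation_graph t)) ->
  phi G = psi G.
Proof.
move=> cphi cpsi E; apply: (wijsman_closure_eq cphi cpsi _ (mem_set clG)).
by move=> F; rewrite inE => -[t _ <-]; exact: E.
Qed.

Lemma closure_dist_inl f r :
  dist_set ((inl f, r) : lines remote) (set_val G) = trunc_dist r (limit_value G f).
Proof.
apply: (closure_eq (phi := fun F => dist_set _ (set_val F))
  (psi := fun F => trunc_dist r (limit_value F f))) => [||t].
- exact: continuous_dist_set.
- move=> F; apply: (@continuous_comp _ _ _ (limit_value ^~ f)).
    exact: continuous_limit_value.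
  exact: continuous_trunc_dist.
- by rewrite limit_value_evaluation dist_evaluation_graph_inl.
Qed.

Lemma closure_dist_inr l r :
  dist_set ((inr l, r) : lines remote) (set_val G) = 1.
Proof.
apply: (closure_eq (phi := fun F => dist_set _ (set_val F)) (psi := cst 1)) => [||t].
- exact: continuous_dist_set.
- exact: cst_continuous.
- by rewrite dist_evaluation_graph_inr.
Qed.

(** [G] is the zero set of its distance function, which the two preceding lemmas determine on all
    lines. *)
Lemma closure_graph : set_val G = graph (limit_value G).
Proof.
have [cG G0] := set_valP (G : nonempty_closed (lines remote)).
apply/seteqP; split=> [[[f|l] r] /(dist_set_eq0 _ cG G0)|_ [f _ <-]].
- by rewrite closure_dist_inl => /trunc_dist_eq0 ->; exists f.
- by rewrite closure_dist_inr => /eqP; rewrite oner_eq0.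
- by apply/(dist_set_eq0 _ cG G0); rewrite closure_dist_inl trunc_distxx.
Qed.

(** A remote limit functional would own a line, at distance 1 from [G] as a limit of evaluation
    graphs but at distance 2 from [G] as its own graph. *)
Lemma closure_not_remote : ~ remote (limit_value G).
Proof.
move=> rG; pose l : remote := SigSub (mem_set rG).
have := closure_dist_inr l 0; rewrite closure_graph.
by rewrite (dist_graph_inr_self l 0 zero_function) => /eqP; rewrite pnatr_eq1.
Qed.

Lemma closure_evaluation t :
  (forall f, `|evaluation t f - limit_value G f| < 1) ->
  limit_value G = evaluation t.
Proof.
move=> near_t; apply/funext => f; apply: contrapT => neq.
pose c := `|limit_value G f - evaluation t f|.
have c0 : 0 < c by rewrite normr_gt0 subr_eq0; exact/eqP.
(* Rescaling by the gap [c] sends the evaluation at [t] to 0 and the limit value to 1. *)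
pose h (x : R) := Num.min (`|x - evaluation t f| / c) 1.
have ch : continuous h.
  move=> x; apply: (@continuous_min _ _ (fun x => `|x - evaluation t f| / c) (cst 1)).
    apply: cvgMl; apply: cvg_norm.
    by apply: cvgB; [exact: cvg_id|exact: cvg_cst].
  exact: cvg_cst.
have gP : (h \o evaluation ^~ f) \in unit_functions.
  rewrite inE; split=> [u|u /=]; last first.
    by rewrite /h le_min ge_min lexx ler01 orbT !andbT divr_ge0// ltW.
  by apply: continuous_comp; [exact: continuous_evaluation|exact: ch].
pose g : unit_functions := SigSub gP.
have gt : evaluation t g = 0.
  have -> : evaluation t g = h (evaluation t f) by [].
  by rewrite /h subrr normr0 mul0r min_l// ler01.
have gG : limit_value G g = 1.
  (* Evaluations commute with postcomposition by [h], and continuity extends this to the limit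
     [G]. *)
  have -> : limit_value G g = h (limit_value G f).
    apply: (closure_eq (phi := limit_value ^~ g) (psi := h \o limit_value ^~ f)).
    - exact: continuous_limit_value.
    - by move=> F; apply: continuous_comp; [exact: continuous_limit_value|exact: ch].
    - by move=> u /=; rewrite !limit_value_evaluation.
  by rewrite /h divff ?gt_eqF// minxx.
by have := near_t g; rewrite gt gG sub0r normrN normr1 ltxx.
Qed.

End Closure.

(** * Closedness of the range and the homeomorphism onto it *)

Lemma closed_range_evaluation_graph : closed (range evaluation_graph).
Proof.
move=> G clG; have [t near_t] : exists t, forall f, `|evaluation t f - limit_value G f| < 1.
  have /existsNP[t /forallNP tG] := closure_not_remote clG.
  by exists t => f; rewrite ltNge; apply/negP; exact: tG.
exists t => //; apply: val_inj; rewrite -[RHS]/(set_val G) (closure_graph clG).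
by rewrite (closure_evaluation clG near_t).
Qed.

Lemma separating_function : completely_regular_space T ->
  forall (t : T) (B : set T), nbhs t B ->
  exists f, evaluation t f = 0 /\ forall u, evaluation u f < 1 -> B u.
Proof.
move=> creg t B /=; rewrite nbhsE => -[U [oU Ut] UB].
have /(@uniform_separatorP _ R)[f [cf f01 f0 f1]] :
    uniform_separator [set t] (~` U).
  by apply: creg; [exact: open_closedC|exact].
have fP : f \in unit_functions.
  by rewrite inE; split=> // u; have /f01 := imageT f u; rewrite /= in_itv.
exists (SigSub fP); split=> [|u].
  by apply: f0; exists t.
move=> fu; apply: UB; apply: contrapT => nUu.
have fu1 : f u = 1 by apply: f1; exists u.
by move: fu; rewrite -[evaluation _ _]/(f u) fu1 ltxx.
Qed.

(** The T1 axiom gives an open set containing [t] but not [u]; a function vanishing at [t] and equal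
    to 1 off that set tells them apart. *)
Lemma evaluation_inj : tychonoff_space T -> injective evaluation.
Proof.
move=> [T1 creg] t u tu; apply: contrapT => /eqP/T1[A [oA]].
rewrite !inE => At; apply.
have [f [ft fA]] := separating_function creg (open_nbhs_nbhs (conj oA At)).
by apply: fA; rewrite -tu ft ltr01.
Qed.

Lemma homeomorphic_range_evaluation_graph :
  tychonoff_space T -> homeomorphic T (range evaluation_graph).
Proof.
move=> tych.
have imP t : evaluation_graph t \in range evaluation_graph by rewrite inE; exists t.
have preP (F : range evaluation_graph) : {t | evaluation_graph t = set_val F}.
  by apply: cid; have [t _ tF] := set_valP F; exists t.
have preK t (F : range evaluation_graph) :
    evaluation_graph t = set_val F -> projT1 (preP F) = t.
  move=> tF; apply: evaluation_inj => //; apply: eq_evaluation_graph.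
  by rewrite tF; exact: (projT2 (preP F)).
exists (fun t => SigSub (imP t)), (fun F => projT1 (preP F)); split.
- by move=> t; exact: preK.
- by move=> F; apply: val_inj => /=; exact: (projT2 (preP F)).
- by apply: continuous_comp_initial; exact: continuous_evaluation_graph.
(* Continuity of the inverse: the condition that the limit value at [f] be below 1 is open in the
   hyperspace and forces the preimage into [B]. *)
- move=> F B /= /(separating_function tych.2)[f [f0 fB]].
  have cv : continuous ((limit_value ^~ f) \o (set_val : range evaluation_graph -> _)).
    move=> H; apply: continuous_comp; last exact: continuous_limit_value.
    exact: initial_continuous.
  have FE H : limit_value (set_val H) f = evaluation (projT1 (preP H)) f.
    by case: (preP H) => t /= <-; rewrite limit_value_evaluation.
  have : \forall H \near F, limit_value (set_val H) f < 1.
    by apply: (cvgr_lt _ (cv F)); rewrite /= FE f0 ltr01.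
  by apply: filterS => H; rewrite FE; exact: fB.
Qed.

End Embedding.

Theorem theorem3p8 (R : realType) (T : topologicalType) :
  tychonoff_space T ->
  exists X : metricType R,
    [/\ complete_space X,
        locally_real R X &
        exists C : set (wijsman X),
          closed C /\ homeomorphic T (set_type C)].
Proof.
move=> tych; exists (lines (@remote R T)); split.
- exact: lines_complete.
- exact: lines_locally_real.
- exists (range (@evaluation_graph R T)); split.
    exact: closed_range_evaluation_graph.
  exact: homeomorphic_range_evaluation_graph.
Qed.
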